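(* Let $\mathbf{A}$ be a random closed set in $\mathbb{R}^d$ with $\partial\mathbf{A}\neq\emptyset$ almost surely and $E|b_{\mathbf{A}}(x_0)|<\infty$ for some $x_0$. If $\mathbf{A}$ is convex almost surely, then the expected set $E[\mathbf{A}]$ is convex.
   Context: Let $(\Omega, \mathscr{A}, \mathbf{P})$ be a probability space and $\mathcal{F}$ the family of closed subsets of $\mathbb{R}^d$. A random closed set is a map $\mathbf{A}:\Omega\to\mathcal{F}$ such that $\{\omega : \mathbf{A}(\omega)\cap K \neq \emptyset\} \in \mathscr{A}$ for every compact $K\subset\mathbb{R}^d$. For a nonempty set $A\subset\mathbb{R}^d$ let $d_A(x)=\inf_{y\in A}|x-y|$ (Euclidean norm). For a set $A\subset\mathbb{R}^d$ with $\partial A\ne\emptyset$, the oriented distance function (ODF) is $b_A(x) = d_A(x) - d_{A^c}(x)$, $x\in\mathbb{R}^d$; it is $1$-Lipschitz in $x$. For a random closed set $\mathbf{A}$ with $\partial\mathbf{A}\neq\emptyset$ a.s. and $E|b_{\mathbf{A}}(x_0)|<\infty$ for some $x_0$ (equivalently for all $x_0\in\mathbb{R}^d$), the expected set is $$E[\mathbf{A}] = \{x\in\mathbb{R}^d : E[b_{\mathbf{A}}(x)] \le 0\}.$$ *)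

(* Defs.v *)
From HB Require Import structures.
From mathcomp Require Import all_boot all_order all_algebra.
From mathcomp Require Import all_classical all_reals all_analysis.
Set Implicit Arguments.
Unset Strict Implicit.
Unset Printing Implicit Defensive.
Import Order.TTheory GRing.Theory Num.Theory.
Import numFieldNormedType.Exports.
Local Open Scope classical_set_scope.
Local Open Scope ring_scope.

(* R^d is 'rV[R]_d.  The library norm on it is the sup norm, hence a separate
   Euclidean norm; open, closed and compact sets are those of the library
   (entrywise) topology, which is also the Euclidean one. *)
Definition enorm (R : realType) (d : nat) (x : 'rV[R]_d) : R :=
  Num.sqrt (\sum_(i < d) x 0 i ^+ 2).

(* [inf set0 = 0], so the value for [A = set0] carries no meaning. *)
Definition set_dist (R : realType) (d : nat) (A : set 'rV[R]_d)
    (x : 'rV[R]_d) : R :=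
  inf [set enorm (x - y) | y in A].

Definition boundary (T : topologicalType) (A : set T) : set T :=
  closure A `\` interior A.

Definition odf (R : realType) (d : nat) (A : set 'rV[R]_d) (x : 'rV[R]_d) : R :=
  set_dist A x - set_dist (~` A) x.

Definition random_closed_set (R : realType) (disp : measure_display)
    (Omega : measurableType disp) (d : nat) (A : Omega -> set 'rV[R]_d) : Prop :=
  (forall w, closed (A w)) /\
  (forall K : set 'rV[R]_d, compact K ->
     measurable [set w | A w `&` K !=set0]).

Definition expected_set (R : realType) (disp : measure_display)
    (Omega : measurableType disp) (P : probability Omega R) (d : nat)
    (A : Omega -> set 'rV[R]_d) : set 'rV[R]_d :=
  [set x | ('E_P[fun w => odf (A w) x] <= 0)%E].

(* Main.v *)
(* Let A be neither empty nor the whole space.  Then b_A(x) <= c iff for every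
   e > 0 some closed ball B(p, r) contained in A has |x - p| - r <= c + e.  If A
   is convex, it contains the convex combinations of such balls, so b_A is
   convex, with no case distinction on the position of the points.  This passes
   to the expectation, b_A(x) being measurable (as {d_A(x) < r} and
   {d_(A^c)(x) < r} are countable combinations of hitting events of compact
   sets) and integrable (as b_A is 1-Lipschitz). *)
Require Import Defs.
From HB Require Import structures.
From mathcomp Require Import all_boot all_order all_algebra.
From mathcomp Require Import all_classical all_reals all_analysis.
From mathcomp Require Import measurable_realfun ring lra.
Set Implicit Arguments.
Unset Strict Implicit.
Unset Printing Implicit Defensive.
Import Order.TTheory GRing.Theory Num.Theory.
Import numFieldNormedType.Exports.
Local Open Scope classical_set_scope.
Local Open Scope ring_scope.

(** * Euclidean norm: triangle inequality, continuity, compact balls *)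

Section euclidean_norm.
Context {R : realType} {d : nat}.
Implicit Types x y : 'rV[R]_d.

Lemma enorm_ge0 x : 0 <= enorm x.
Proof. exact: sqrtr_ge0. Qed.

Lemma enorm_sqr x : enorm x ^+ 2 = \sum_(i < d) x 0 i ^+ 2.
Proof. by rewrite sqr_sqrtr// sumr_ge0// => i _; exact: sqr_ge0. Qed.

Lemma enorm0 : enorm (0 : 'rV[R]_d) = 0.
Proof. by rewrite /enorm big1 ?sqrtr0// => i _; rewrite mxE expr0n. Qed.

Lemma enormZ a x : enorm (a *: x) = `|a| * enorm x.
Proof.
rewrite /enorm -sqrtr_sqr -sqrtrM ?sqr_ge0// mulr_sumr.
by congr Num.sqrt; apply: eq_bigr => i _; rewrite mxE exprMn.
Qed.

Lemma enormN x : enorm (- x) = enorm x.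
Proof. by rewrite -scaleN1r enormZ normrN1 mul1r. Qed.

Lemma enorm_distC x y : enorm (x - y) = enorm (y - x).
Proof. by rewrite -enormN opprB. Qed.

Lemma coord_le_enorm x i : `|x 0 i| <= enorm x.
Proof.
rewrite -sqrtr_sqr /enorm ler_sqrt; last first.
  by apply: sumr_ge0 => j _; exact: sqr_ge0.
by rewrite (bigD1 i)//= lerDl sumr_ge0// => j _; exact: sqr_ge0.
Qed.

Lemma enorm_eq0 x : enorm x = 0 -> x = 0.
Proof.
move=> x0; apply/rowP => i; rewrite mxE; apply/eqP.
by rewrite -normr_le0 -x0 coord_le_enorm.
Qed.

Lemma enorm_sub_le0 x y : enorm (x - y) <= 0 -> x = y.
Proof.
move=> xy; apply/eqP; rewrite -subr_eq0; apply/eqP/enorm_eq0/eqP.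
by rewrite eq_le xy enorm_ge0.
Qed.

(** Expanding the squared length of |y| x - |x| y gives 2 |x| |y| (|x| |y| - <x, y>), which is
    nonnegative. Zero vectors are set apart so that the factor 2 |x| |y| can be cancelled. *)
Lemma enorm_cauchy_schwarz x y :
  \sum_(i < d) x 0 i * y 0 i <= enorm x * enorm y.
Proof.
have [x0|x0] := eqVneq (enorm x) 0.
  by rewrite (enorm_eq0 x0) enorm0 mul0r big1// => i _; rewrite mxE mul0r.
have [y0|y0] := eqVneq (enorm y) 0.
  by rewrite (enorm_eq0 y0) enorm0 mulr0 big1// => i _; rewrite mxE mulr0.
have {}x0 : 0 < enorm x by rewrite lt_neqAle eq_sym x0 enorm_ge0.
have {}y0 : 0 < enorm y by rewrite lt_neqAle eq_sym y0 enorm_ge0.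
have sq0 : 0 <= \sum_(i < d) (enorm y * x 0 i - enorm x * y 0 i) ^+ 2.
  by apply: sumr_ge0 => i _; exact: sqr_ge0.
have : 0 <= 2 * (enorm x * enorm y) *
    (enorm x * enorm y - \sum_(i < d) x 0 i * y 0 i).
  apply: le_trans sq0 _; rewrite le_eqVlt; apply/orP; left; apply/eqP.
  rewrite [LHS](eq_bigr (fun i => enorm y ^+ 2 * x 0 i ^+ 2 +
    enorm x ^+ 2 * y 0 i ^+ 2 - 2 * (enorm x * enorm y) * (x 0 i * y 0 i)));
    last by move=> i _; ring.
  rewrite sumrB big_split/= -!mulr_sumr -!enorm_sqr; ring.
by rewrite pmulr_rge0 ?subr_ge0// !mulr_gt0.
Qed.

Lemma ler_enormD x y : enorm (x + y) <= enorm x + enorm y.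
Proof.
rewrite -ler_sqr ?nnegrE ?addr_ge0 ?enorm_ge0// sqrrD !enorm_sqr.
rewrite (eq_bigr (fun i => x 0 i ^+ 2 + 2 * (x 0 i * y 0 i) + y 0 i ^+ 2));
  last by move=> i _; rewrite mxE; ring.
rewrite !big_split/= -mulr_sumr.
rewrite -[enorm x * _ *+ 2]mulr_natl lerD2r lerD2l ler_pM2l//.
exact: enorm_cauchy_schwarz.
Qed.

Lemma ler_enorm_distD x y z : enorm (x - z) <= enorm (x - y) + enorm (y - z).
Proof. by rewrite -[x - z](subrKA y) ler_enormD. Qed.

Lemma enorm_continuous : continuous (@enorm R d).
Proof.
move=> x; apply: (@continuous_comp _ _ _
  (fun x : 'rV[R]_d => \sum_(i < d) x 0 i ^+ 2) Num.sqrt);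
  last exact: sqrt_continuous.
apply: (continuous_big (op := +%R)) => [|i _] {}x; first exact: add_continuous.
apply: (@continuous_comp _ _ _ (fun x : 'rV[R]_d => x 0 i)
  (fun t : R => t ^+ 2)); [exact: coord_continuous|exact: exprn_continuous].
Qed.

Lemma enorm_sub_continuous x : continuous (fun y => enorm (x - y)).
Proof.
move=> y; apply: (@continuous_comp _ _ _ (fun y => x - y) (@enorm R d));
  last exact: enorm_continuous.
by apply: continuousB; [exact: cst_continuous|exact: cvg_id].
Qed.

(** These balls serve as compact test sets for random closed sets. They are closed by continuity of
    [enorm], and bounded because the sup norm is at most the Euclidean one. *)
Lemma compact_enorm_ball x r : compact [set y | enorm (x - y) <= r].
Proof.
apply: bounded_closed_compact; last first.
  by have /continuous_closedP/(_ _ (@closed_le R r)) := @enorm_sub_continuous x.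
exists (enorm x + r); split => [|M /ltW rM y /= xy]; first exact: num_real.
rewrite [leLHS]/Num.norm/= mx_normrE; apply: bigmax_le => [|[i j] _ /=].
  apply: le_trans rM; rewrite addr_ge0 ?enorm_ge0//.
  exact: le_trans (enorm_ge0 _) xy.
rewrite ord1 (le_trans (coord_le_enorm _ _))// (le_trans _ rM)//.
rewrite -[y](addrNK x) addrC (le_trans (ler_enormD _ _))// lerD2l.
by rewrite enorm_distC.
Qed.

End euclidean_norm.

(** * Oriented distance: inner balls, Lipschitz bound, convexity *)

Section oriented_distance.
Context {R : realType} {d : nat}.
Implicit Types (A : set 'rV[R]_d) (x y p : 'rV[R]_d).

Lemma set_dist_le A x y : A y -> set_dist A x <= enorm (x - y).
Proof.
move=> Ay; apply: ge_inf; last by exists y.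
by exists 0 => _ [z _ <-]; exact: enorm_ge0.
Qed.

Lemma set_dist_ge A x c : A !=set0 ->
  (forall y, A y -> c <= enorm (x - y)) -> c <= set_dist A x.
Proof.
move=> [y Ay] cA; apply: lb_le_inf; first by exists (enorm (x - y)), y.
by move=> _ [z Az <-]; exact: cA.
Qed.

Lemma set_dist_lt A x c : A !=set0 -> set_dist A x < c ->
  exists2 y, A y & enorm (x - y) < c.
Proof.
move=> [y Ay] /inf_lt[|_ [z Az <-] zc]; last by exists z.
by exists (enorm (x - y)), y.
Qed.

Lemma set_dist_ge0 A x : 0 <= set_dist A x.
Proof.
have [[y Ay]|/set0P/negP] := pselect (A !=set0).
  by apply: set_dist_ge => [|z _]; [exists y|exact: enorm_ge0].
by rewrite negbK => /eqP ->; rewrite /set_dist image_set0 inf0.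
Qed.

Lemma set_dist_in A x : A x -> set_dist A x = 0.
Proof.
move=> Ax; apply/eqP; rewrite eq_le set_dist_ge0 andbT.
by rewrite (le_trans (set_dist_le x Ax))// subrr enorm0.
Qed.

(** Excludes the default value of the distance to an empty set, both for A and for its
    complement. *)
Lemma boundary_nonempty A : boundary A !=set0 -> A !=set0 /\ ~` A !=set0.
Proof.
move=> [x [clx intx]]; split.
  by have /(_ setT)[|y [Ay _]] := clx; [exact: filterT|exists y].
apply/set0P/negP => /eqP A0; apply: intx.
by rewrite -(setCK A) A0 setC0 interiorT.
Qed.

(* Treats points of A and points outside A uniformly: in the first case the
   ball is centered at x, in the second it is a point of A close to x. *)
Definition near_inner_ball A x c := exists p rho,
  [/\ 0 <= rho, forall y, enorm (y - p) <= rho -> A y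
    & enorm (x - p) - rho <= c].

(** For x in A and c < 0, the complement is farther than -c from x, so the ball of radius -c about x
    lies in A. For x outside A the infimum may not be attained, but the strict inequality still
    gives a point of A closer than c. *)
Lemma odf_near_inner_ball A x c : A !=set0 ->
  odf A x < c -> near_inner_ball A x c.
Proof.
rewrite /odf => A0; have [Ax|cAx] := pselect (A x).
  rewrite (set_dist_in Ax) => xc.
  have [c0|c0] := leP 0 c.
    exists x, 0; split => // [y /enorm_sub_le0 ->//|].
    by rewrite subrr enorm0 subr0.
  exists x, (- c); split; [by rewrite oppr_ge0 ltW| |].
    move=> y yx; apply: contrapT => Ay; have := @set_dist_le (~` A) x y Ay.
    by rewrite enorm_distC; lra.
  by rewrite subrr enorm0 opprK add0r.
rewrite (@set_dist_in (~` A))// subr0 => /(set_dist_lt A0)[p Ap xp].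
by exists p, 0; split => // [y /enorm_sub_le0 ->//|]; rewrite subr0 ltW.
Qed.

Lemma near_inner_ball_odf A x c : ~` A !=set0 ->
  near_inner_ball A x c -> odf A x <= c.
Proof.
rewrite /odf => cA0 [p [r [r0 Ar xc]]]; apply: le_trans xc.
have [Ax|cAx] := pselect (A x).
  rewrite (set_dist_in Ax) sub0r lerNl opprB; apply: set_dist_ge => // y Ay.
  (* Every y outside A is farther than r from p, hence farther than r - |x - p| from x. *)
  have : r < enorm (y - p) by rewrite ltNge; apply/negP => /Ar.
  have := ler_enorm_distD y x p; rewrite (enorm_distC y x); lra.
rewrite (@set_dist_in (~` A))// subr0.
have xr : r < enorm (x - p) by rewrite ltNge; apply/negP => /Ar.
have x0 : 0 < enorm (x - p) by exact: le_lt_trans xr.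
(* With this [t], the point p + t (x - p) of the segment from p to x is at distance r from p, so it
   lies in A, and at distance |x - p| - r from x. *)
set t := r / enorm (x - p).
have t0 : 0 <= t by rewrite divr_ge0// ltW.
have t1 : 0 <= 1 - t by rewrite subr_ge0 ler_pdivrMr// mul1r ltW.
have tx : t * enorm (x - p) = r by rewrite divfK// gt_eqF.
have Ay : A (p + t *: (x - p)).
  by apply: Ar; rewrite addrC addKr enormZ ger0_norm// tx.
rewrite (le_trans (set_dist_le x Ay))// opprD addrA.
rewrite -{1}[x - p]scale1r -scalerBl enormZ ger0_norm//.
by rewrite mulrBl mul1r tx.
Qed.

(** A ball that is nearly optimal for y also serves x: moving from y to x increases the distance to
    its center by at most |x - y|. *)
Lemma odf_lipschitz A x y : A !=set0 -> ~` A !=set0 ->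
  odf A x <= odf A y + enorm (x - y).
Proof.
move=> A0 cA0; apply/ler_addgt0Pr => e e0.
apply: near_inner_ball_odf => //.
have /(odf_near_inner_ball A0)[p [r [r0 Ar yp]]] : odf A y < odf A y + e.
  by rewrite ltrDl.
exists p, r; split => //; have := ler_enorm_distD x y p; lra.
Qed.

Lemma near_inner_ball_convex A x y a b (t : {i01 R}) : convex_set A ->
  near_inner_ball A x a -> near_inner_ball A y b ->
  near_inner_ball A (t%:num *: x + (1 - t%:num) *: y)
    (t%:num * a + (1 - t%:num) * b).
Proof.
move=> cA [p [r [r0 Ar xp]]] [q [s [s0 As yq]]].
have u0 : 0 <= t%:num by [].
have u1 : 0 <= 1 - t%:num by rewrite subr_ge0.
set u := t%:num in u0 u1 *.
exists (u *: p + (1 - u) *: q), (u * r + (1 - u) * s); split.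
- by rewrite addr_ge0// mulr_ge0.
- move=> z; have := esym (subrK (u *: p + (1 - u) *: q) z).
  move: (z - _) => v zE; set w := u * r + (1 - u) * s => vw.
  (* Split v into parts of lengths at most u r and (1 - u) s. *)
  pose k := (w^-1 : R).
  (* If w = 0, then k = 0 by the convention for inverses, but |v| <= w forces v = 0 as well. *)
  have kv : (k * w) *: v = v.
    have [w0|w0] := eqVneq w 0; last by rewrite mulVf// scale1r.
    suff -> : v = 0 by rewrite scaler0.
    by apply: enorm_eq0; apply/eqP; rewrite eq_le enorm_ge0 andbT -w0.
  have w_ge0 : 0 <= w by rewrite /w addr_ge0// mulr_ge0.
  have k0 : 0 <= k by rewrite invr_ge0.
  have kv1 : k * enorm v <= 1.
    have [w0|w0] := eqVneq w 0; first by rewrite /k w0 invr0 mul0r.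
    by rewrite mulrC ler_pdivrMr ?mul1r// lt_neqAle eq_sym w0.
  have Ap : A (p + (k * r) *: v).
    apply: Ar; rewrite addrC addKr enormZ ger0_norm ?mulr_ge0//.
    by rewrite mulrAC ler_piMl.
  have Aq : A (q + (k * s) *: v).
    apply: As; rewrite addrC addKr enormZ ger0_norm ?mulr_ge0//.
    by rewrite mulrAC ler_piMl.
  suff -> : z = u *: (p + (k * r) *: v) + (1 - u) *: (q + (k * s) *: v).
    by have := cA _ _ t (mem_set Ap) (mem_set Aq); rewrite inE.
  rewrite !scalerDr !scalerA addrACA -scalerDl.
  rewrite (_ : u * (k * r) + (1 - u) * (k * s) = k * w);
    last by rewrite /w; ring.
  by rewrite kv addrC.
- rewrite opprD addrACA -!scalerBr.
  have := ler_enormD (u *: (x - p)) ((1 - u) *: (y - q)).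
  rewrite !enormZ !ger0_norm//.
  have := ler_wpM2l u0 xp; have := ler_wpM2l u1 yq; lra.
Qed.

Lemma odf_convex A x y (t : {i01 R}) : convex_set A -> A !=set0 ->
  ~` A !=set0 ->
  odf A (t%:num *: x + (1 - t%:num) *: y) <=
    t%:num * odf A x + (1 - t%:num) * odf A y.
Proof.
move=> cA A0 cA0; apply/ler_addgt0Pr => e e0; apply: near_inner_ball_odf => //.
have ltD c : c < c + e by rewrite ltrDl.
(* Since the weights sum to 1, the slack e can be granted at x and at y separately, which makes both
   inequalities strict. *)
have -> : t%:num * odf A x + (1 - t%:num) * odf A y + e =
  t%:num * (odf A x + e) + (1 - t%:num) * (odf A y + e) by ring.
by apply: near_inner_ball_convex => //; apply: odf_near_inner_ball.
Qed.

End oriented_distance.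

(** * Measurability of the oriented distance *)

Lemma dense_rat_rV (R : realType) (d : nat) :
  dense (range (map_mx (@ratr R) : 'rV[rat]_d -> 'rV[R]_d)).
Proof.
move=> U [x Ux] /(_ _ Ux)/nbhs_ballP[e /= e0 xeU].
(* The library ball is a box, so rational coordinates can be chosen one at a time. *)
have /choice[q qP] i : exists q : rat, x 0 i - e < ratr q < x 0 i + e.
  have /rat_in_itvoo[q] : x 0 i - e < x 0 i + e by lra.
  by rewrite in_itv/=; exists q.
exists (map_mx ratr (\row_i q i)); split; last by exists (\row_i q i).
apply: xeU; split => // i j; rewrite ord1 !mxE /ball/= distrC ltr_distl.
exact: qP.
Qed.

Lemma measurable_set_dist (R : realType) (disp : measure_display)
    (Omega : measurableType disp) (d : nat) (B : Omega -> set 'rV[R]_d)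
    (x : 'rV[R]_d) :
  (forall r, measurable [set w | B w `&` [set y | enorm (x - y) < r] !=set0]) ->
  measurable_fun setT (fun w => set_dist (B w) x).
Proof.
move=> mB; apply: (measurability _ (RGenInftyO.measurableE R)) => //.
move=> _ [_ [r ->] <-]; rewrite setTI.
have [r0|r0] := leP r 0.
  rewrite (_ : _ @^-1` _ = set0)//; apply/seteqP; split => // w /=.
  by rewrite in_itv/= => /lt_le_trans/(_ r0); rewrite ltNge set_dist_ge0.
(* A set is nonempty iff it hits a ball about x of some integer radius. *)
have mB0 : measurable [set w | B w !=set0].
  rewrite (_ : mkset _ = \bigcup_n [set w |
    B w `&` [set y | enorm (x - y) < n%:R] !=set0]);
    first exact: bigcup_measurable.
  apply/seteqP; split => [w [y Bwy]|w [n _ [y [Bwy _]]]]; last by exists y.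
  have [n yn] : exists n : nat, enorm (x - y) < n%:R.
    by exists (Num.truncn (enorm (x - y))).+1; rewrite truncnS_gt.
  by exists n => //; exists y.
(* The junk value set_dist set0 x = 0 puts the event that B is empty in the
   preimage. *)
rewrite (_ : _ @^-1` _ = [set w | B w `&` [set y | enorm (x - y) < r] !=set0]
  `|` ~` [set w | B w !=set0]); last first.
  apply/seteqP; split => w /=; rewrite in_itv/=.
    have [B0|] := pselect (B w !=set0); last by right.
    by move=> /(set_dist_lt B0)[y Bwy yr]; left; exists y.
  case=> [[y [Bwy yr]]|/set0P/negP].
    exact: le_lt_trans (set_dist_le x Bwy) yr.
  by rewrite negbK => /eqP ->; rewrite /set_dist image_set0 inf0.
by apply: measurableU => //; exact: measurableC.
Qed.

Section random_closed_set.
Context {R : realType} {disp : measure_display} {Omega : measurableType disp}.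
Context {d : nat} {A : Omega -> set 'rV[R]_d} (A_random : random_closed_set A).

(** An open ball is the countable union of the closed balls of radii r - 1/(n+1), which are
    compact. *)
Lemma measurable_hits_ball x r :
  measurable [set w | A w `&` [set y | enorm (x - y) < r] !=set0].
Proof.
rewrite (_ : mkset _ = \bigcup_n
    [set w | A w `&` [set y | enorm (x - y) <= r - n.+1%:R^-1] !=set0]).
  apply: bigcup_measurable => n _; apply: A_random.2.
  exact: compact_enorm_ball.
apply/seteqP; split => [w [y [Awy yr]]|w [n _ [y [Awy yr]]]].
  have [n nr] : exists n : nat, n.+1%:R^-1 < r - enorm (x - y).
    have r0 : 0 < r - enorm (x - y) by rewrite subr_gt0.
    by have [n _ /(_ n (leqnn n))] := near_infty_natSinv_lt (PosNum r0);
      exists n.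
  by exists n => //; exists y; split => //=; rewrite lerBrDr -lerBrDl ltW.
exists y; split => //=; apply: le_lt_trans yr _.
by rewrite ltrBlDr ltrDl invr_gt0.
Qed.

(* Since A is closed, its complement hits an open ball iff it contains a
   rational point of it. *)
Lemma measurable_setC_hits_ball x r :
  measurable [set w | ~` A w `&` [set y | enorm (x - y) < r] !=set0].
Proof.
pose ratv := map_mx (@ratr R) : 'rV[rat]_d -> 'rV[R]_d.
rewrite (_ : mkset _ = \bigcup_(q in [set q | enorm (x - ratv q) < r])
    ~` [set w | A w `&` [set ratv q] !=set0]).
  (* Rational vectors are countable, and missing one of them is the complement of hitting a compact
     singleton. *)
  rewrite bigcup_mkcond; apply: countable_bigcupT_measurable => // q.
  case: ifP => // _; apply: measurableC; apply: A_random.2.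
  exact: compact_set1.
apply/seteqP; split => [w Awr|w [q qr Awq]].
  have [|y [[cAwy yr] [q _ qy]]] := @dense_rat_rV R d _ Awr.
    apply: openI; first by apply: closed_openC; exact: A_random.1.
    rewrite (_ : mkset _ = (fun y => enorm (x - y)) @^-1` [set s | s < r])//.
    apply: open_comp => [y _|]; last exact: open_lt.
    exact: enorm_sub_continuous.
  rewrite -qy in cAwy yr; exists q => // -[z [/[swap] ->]].
  exact: cAwy.
by exists (ratv q); split => // Awy; apply: Awq; exists (ratv q).
Qed.

Lemma measurable_odf x : measurable_fun setT (fun w => odf (A w) x).
Proof.
apply: measurable_funB; apply: measurable_set_dist => r.
  exact: measurable_hits_ball.
exact: measurable_setC_hits_ball.
Qed.

End random_closed_set.

(** * Integrability and passage to the expectation *)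

Lemma ae_le_integral (R : realType) (disp : measure_display)
    (T : measurableType disp) (mu : {measure set T -> \bar R})
    (f g : T -> \bar R) :
  mu.-integrable setT f -> mu.-integrable setT g ->
  {ae mu, forall x, (f x <= g x)%E} ->
  (\int[mu]_x f x <= \int[mu]_x g x)%E.
Proof.
move=> intf intg [N [mN N0 fgN]].
have mNC : measurable (setT `\` N) by exact: measurableD.
(* Removing the null set [N] changes neither integral, and off [N] the inequality holds at every
   point. *)
rewrite (negligible_integral mN _ intf)// (negligible_integral mN _ intg)//.
apply: le_integral => //; [exact: integrableS intf|exact: integrableS intg|].
move=> x; rewrite inE => -[_ Nx]; apply: contrapT => fg.
exact/Nx/fgN.
Qed.

Lemma integrable_odf (R : realType) (disp : measure_display)
    (Omega : measurableType disp) (P : probability Omega R) (d : nat)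
    (A : Omega -> set 'rV[R]_d) (x0 x : 'rV[R]_d) :
  random_closed_set A ->
  {ae P, forall w, boundary (A w) !=set0} ->
  ('E_P[fun w => `|odf (A w) x0|%R] < +oo)%E ->
  P.-integrable setT (fun w => (odf (A w) x)%:E).
Proof.
move=> A_random A_boundary; rewrite unlock => A_x0.
have mA y := measurable_odf A_random y.
apply/integrableP; split; first exact/measurable_EFinP.
(* By the Lipschitz bound, |b_A(x)| <= |b_A(x0)| + |x - x0| almost surely; the constant has finite
   integral because P has mass 1. *)
apply: (@le_lt_trans _ _
  (\int[P]_w ((`|odf (A w) x0| + enorm (x - x0))%:E))%E).
  apply: ae_ge0_le_integral => //.
  - by apply/measurableT_comp => //; exact/measurable_EFinP.
  - by move=> w _; rewrite lee_fin addr_ge0// enorm_ge0.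
  - apply/measurable_EFinP; apply: measurable_funD => //.
    exact: measurableT_comp.
  - near=> w => _; rewrite lee_fin.
    have [A0 cA0] : A w !=set0 /\ ~` A w !=set0.
      by apply: boundary_nonempty; near: w.
    have := odf_lipschitz x x0 A0 cA0.
    have := odf_lipschitz x0 x A0 cA0; rewrite (enorm_distC x0).
    have := ler_norm (odf (A w) x0); have := ler_norm (- odf (A w) x0).
    by rewrite normrN ler_norml; lra.
under eq_integral do rewrite EFinD.
rewrite ge0_integralD//; last 2 first.
- by apply/measurable_EFinP; exact: measurableT_comp.
- by move=> w _; rewrite lee_fin enorm_ge0.
by rewrite lte_add_pinfty// integral_cst//= probability_setT mule1 ltry.
Unshelve. all: by end_near. Qed.

Theorem theorem3p3 (R : realType) (disp : measure_display)
    (Omega : measurableType disp) (P : probability Omega R) (d : nat)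
    (A : Omega -> set 'rV[R]_d)
    (A_random : random_closed_set A)
    (A_boundary : {ae P, forall w, boundary (A w) !=set0})
    (A_integrable : exists x0 : 'rV[R]_d,
      ('E_P[fun w => `|odf (A w) x0|%R] < +oo)%E)
    (A_convex : {ae P, forall w, convex_set (A w)}) :
  convex_set (expected_set P A).
Proof.
have [x0 /(integrable_odf _ A_random A_boundary) intA] := A_integrable.
move=> x y t; rewrite !inE /expected_set/= unlock => Ax Ay.
have t0 : 0 <= t%:num by [].
have t1 : 0 <= 1 - t%:num by rewrite subr_ge0.
have intZ k z : P.-integrable setT (fun w => k%:E * (odf (A w) z)%:E)%E.
  exact: integrableZl.
(* Convexity of b_A is integrated almost surely; by linearity the right-hand side is then a
   combination, with nonnegative weights, of two nonpositive expectations. *)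
apply: (@le_trans _ _ (\int[P]_w
    (t%:num%:E * (odf (A w) x)%:E + (1 - t%:num)%:E * (odf (A w) y)%:E))%E).
  apply: ae_le_integral; [exact: intA|exact: integrableD|].
  near=> w.
  have [A0 cA0] : A w !=set0 /\ ~` A w !=set0.
    by apply: boundary_nonempty; near: w.
  have cA : convex_set (A w) by near: w.
  by rewrite -!EFinM -EFinD lee_fin; exact: odf_convex.
by rewrite integralD// !integralZl// adde_le0// mule_ge0_le0.
Unshelve. all: by end_near. Qed.
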